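(* Let $n,k\in\mathbb{N}$, let $s\geq 0$ be an integer, let $\mathbf{a}^{1},\dots,\mathbf{a}^{k}\in\mathbb{R}^{n}$ be pairwise linearly independent vectors, and let $f\in C^{s}(\mathbb{R}^{n})$ be a function of the form $$f(\mathbf{x})=\sum_{i=1}^{k}f_{i}(\mathbf{a}^{i}\cdot\mathbf{x}),\qquad \mathbf{x}\in\mathbb{R}^{n},$$ where $f_{1},\dots,f_{k}:\mathbb{R}\to\mathbb{R}$ are arbitrary functions (no regularity assumed). Then there exist functions $g_{i}\in C^{s}(\mathbb{R})$, $i=1,\dots,k$, and a polynomial $P:\mathbb{R}^{n}\to\mathbb{R}$ of (total) degree at most $k-1$ such that $$f(\mathbf{x})=\sum_{i=1}^{k}g_{i}(\mathbf{a}^{i}\cdot\mathbf{x})+P(\mathbf{x})\qquad\text{for all }\mathbf{x}\in\mathbb{R}^{n}.$$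
   Context: All functions are real-valued. $\mathbf{a}\cdot\mathbf{x}$ denotes the standard inner product on $\mathbb{R}^{n}$. $C^{s}(\mathbb{R}^{n})$ is the class of $s$-times continuously differentiable functions on $\mathbb{R}^{n}$, with the convention $C^{0}(\mathbb{R}^{n})=C(\mathbb{R}^{n})$ (continuous functions). *)

(* Defs.v *)
From HB Require Import structures.
From mathcomp Require Import all_boot all_order all_algebra.
From mathcomp Require Import all_classical all_reals all_analysis.
(* The notations of mpoly clash with those of mathcomp-analysis. *)
From mathcomp Require Import -(notations) mpoly.

Set Implicit Arguments.
Unset Strict Implicit.
Unset Printing Implicit Defensive.

Import Order.TTheory GRing.Theory Num.Theory.
Import numFieldNormedType.Exports.

Local Open Scope ring_scope.

Section Defs.
Context {R : realType}.

Definition dotp {n : nat} (a x : 'rV[R]_n) : R := \sum_(i < n) a 0 i * x 0 i.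

(* C^s(R^n): every iterated partial derivative of order at most s, taken in any
   order of the variables, exists everywhere and is continuous.  The continuity
   of f itself is required at each stage, because for n > 1 it does not follow
   from the mere existence of the partial derivatives. *)
Fixpoint Cdiff {n : nat} (s : nat) (f : 'rV[R]_n -> R) : Prop :=
  if s is s'.+1 then
    continuous f /\
    forall i : 'I_n, (forall x, derivable f x (delta_mx 0 i)) /\
                     Cdiff s' (fun x => 'D_(delta_mx 0 i) f x)
  else continuous f.

(* C^s(R); here differentiability implies continuity. *)
Fixpoint Cdiff1 (s : nat) (g : R -> R) : Prop :=
  if s is s'.+1 then (forall t, derivable g t 1) /\ Cdiff1 s' (derive1 g)
  else continuous g.

Definition evalp {n : nat} (P : mpoly n R) (x : 'rV[R]_n) : R :=
  meval (fun i => x 0 i) P.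

(* mmeasure mdeg P, which the library writes msize P, is the total degree plus
   one, and 0 for P = 0; so the zero polynomial gets degree 0 here. *)
Definition total_degree {n : nat} (P : mpoly n R) : nat :=
  (mmeasure mdeg P).-1.

End Defs.

(* Main.v *)
(* Call Delta_v f = f(. + v) - f.  Restrict f to a plane spanned by generic vectors
   u and v, so that after rescaling the a^i act as x + lam_i y with distinct lam_i.
   There f is annihilated by every product of differences along the level lines of
   these forms.  Averaging, M f (p) = int_0^1 f (p + h b) dh along the level line
   b = (- lam_0, 1), gives f = (f - M f) + M f, where f - M f is annihilated without
   the factor of lam_0 and the derivative of M f along b is Delta_b f, again
   annihilated without it.  By induction f is, on the plane, a sum of continuous
   ridge functions.  For C^s regularity one integrates the decomposition of the
   derivative along u; the error depends on y alone and is a generalized polynomial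
   (annihilated by k arbitrary differences), so its continuous ridge summands are
   generalized polynomials, hence smooth.
   On R^n, the differences f_i - g_i now have ridge functions that sum to zero on the
   plane, so k - 1 differences kill each of them.  Thus f - sum g_i (a^i . x) is a
   continuous generalized polynomial, and by Frechet's theorem a polynomial. *)

Require Import Defs.
From HB Require Import structures.
From mathcomp Require Import all_boot all_order all_algebra.
From mathcomp Require Import all_classical all_reals all_analysis.
From mathcomp Require Import -(notations) mpoly.
From mathcomp Require Import ring lra.

Set Implicit Arguments.
Unset Strict Implicit.
Unset Printing Implicit Defensive.

Import Order.TTheory GRing.Theory Num.Theory.
Import numFieldNormedType.Exports.

Local Open Scope ring_scope.

(** * Primitives *)

Section Calculus.
Context {R : realType}.
Implicit Types f g F G : R -> R.

Lemma is_derive_cst_eq G : (forall x, is_derive x (1 : R) G 0) ->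
  forall x y, G x = G y.
Proof. by move=> dG x y; exact: is_derive_0_is_cst. Qed.

(** The difference [I a x - I a 0] does not depend on a left end [a] below both x and 0. So the left
    end may move with x, and near a given x it can be frozen at [- (M x + 1)], where the fundamental
    theorem of calculus applies. *)
Lemma primitive_exists g : continuous g ->
  exists G, forall x, is_derive x (1 : R) G (g x).
Proof.
move=> cg; pose mu := @lebesgue_measure R.
have int a b : mu.-integrable `[a, b]%classic (EFin \o g).
  apply: continuous_compact_integrable; first exact: segment_compact.
  by apply: continuous_subspaceT.
pose I a x : R := \int[mu]_(t in `[a, x]) g t.
have IE a b x y : a <= b -> b <= x -> b <= y -> I a x - I a y = I b x - I b y.
  wlog yx : x y / y <= x.
    move=> H ab bx by_; have [yx|xy] := leP y x; first exact: H.
    by apply: oppr_inj; rewrite !opprB; apply: H => //; exact: ltW.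
  move=> ab bx by_; rewrite /I !Rintegral_itvB//=.
  by rewrite bnd_simp (le_trans ab).
pose M (x : R) : R := `|x| + 1.
exists (fun x => I (- M x) x - I (- M x) 0) => x.
have xM : - (M x + 1) < x.
  by rewrite /M; have := ler_norm (- x); rewrite normrN; lra.
have [dI DI] : derivable (I (- (M x + 1))) x 1 /\
    (I (- (M x + 1)))^`()%classic x = g x.
  apply: (@continuous_FTC1 _ _ _ _ (x + 1)) => //=.
  - by rewrite ltrDl.
  - exact: cg.
have {dI DI} dI : is_derive x (1 : R) (I (- (M x + 1))) (g x).
  by rewrite -DI derive1E; exact: derivableP.
have : is_derive x (1 : R) (I (- (M x + 1)) - cst (I (- (M x + 1)) 0)) (g x).
  by apply: is_derive_eq; rewrite subr0.
apply: near_eq_is_derive; near=> y.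
have yx : `|y - x| < 1.
  by rewrite distrC; near: y; exact: (nbhsx_ballx x 1).
have ny : `|y| <= `|x| + 1.
  by rewrite -(subrK x y) (le_trans (ler_normD _ _))// addrC lerD2l ltW.
rewrite /= -[LHS]/(I _ y - I _ 0); apply: IE.
- by rewrite lerN2 /M; lra.
- by rewrite /M; have := ler_norm (- y); rewrite normrN; lra.
- by rewrite /M oppr_le0 addr_ge0.
Unshelve. all: by end_near. Qed.

(* The integral of g over [0, 1], read off any primitive of g (junk if g has none). *)
Definition unit_integral g : R :=
  let G := get [set G | forall x, is_derive x (1 : R) G (g x)] in G 1 - G 0.

Lemma unit_integralE g G : (forall x, is_derive x (1 : R) G (g x)) ->
  unit_integral g = G 1 - G 0.
Proof.
move=> dG; rewrite /unit_integral.
set H := get _; have dH : forall x, is_derive x (1 : R) H (g x).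
  exact: (@getPex _ [set G | forall x, is_derive x (1 : R) G (g x)]
    (ex_intro _ G dG)).
have /is_derive_cst_eq/(_ 1 0) : forall x, is_derive x (1 : R) (H - G) 0.
  by move=> x; apply: is_derive_eq; rewrite subrr.
by rewrite -[(H - G) 1]/(H 1 - G 1) -[(H - G) 0]/(H 0 - G 0); lra.
Qed.

Lemma unit_integralB f g : continuous f -> continuous g ->
  unit_integral (fun x => f x - g x) = unit_integral f - unit_integral g.
Proof.
move=> /primitive_exists[F dF] /primitive_exists[G dG].
rewrite (unit_integralE dF) (unit_integralE dG).
rewrite (@unit_integralE _ (F - G)).
by rewrite -[(F - G) 1]/(F 1 - G 1) -[(F - G) 0]/(F 0 - G 0); lra.
Qed.

Lemma unit_integral_cst (c : R) : unit_integral (fun=> c) = c.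
Proof.
have dc (x : R) : is_derive x (1 : R) (c *: (@id R)) c.
  by apply: is_derive_eq; rewrite [_ *: _]mulr1.
by rewrite (unit_integralE dc) -[LHS]/(c * 1 - c * 0) mulr1 mulr0 subr0.
Qed.

Lemma unit_integral_le f (e : R) : continuous f ->
  (forall x, 0 <= x <= 1 -> `|f x| <= e) -> `|unit_integral f| <= e.
Proof.
move=> /primitive_exists[F dF] fe; rewrite (unit_integralE dF).
have [|c c01 ->] := @MVT R F f 0 1 ltr01 (fun x _ => dF x).
  apply: continuous_subspaceT => x.
  by apply/differentiable_continuous/derivable1_diffP; case: (dF x).
rewrite subr0 mulr1; apply: fe; move: c01; rewrite in_itv/= => /andP[c0 c1].
by rewrite !ltW.
Qed.

End Calculus.

(** * Differences and averages *)

Section Differences.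
Context {R : realType}.

Definition fdiff {V : zmodType} (v : V) (f : V -> R) : V -> R :=
  fun x => f (x + v) - f x.

(** Each set in [Ds] holds the admissible steps of one difference. Level lines give the equations
    satisfied by ridge sums, and [setT] gives generalized polynomials, so both share the same
    lemmas. *)
Fixpoint annihilated {V : zmodType} (Ds : seq (set V)) (f : V -> R) : Prop :=
  if Ds is D :: Ds' then forall v, D v -> annihilated Ds' (fdiff v f)
  else forall x, f x = 0.

(* Generalized polynomials, in the sense of Frechet, of degree less than m. *)
Definition gpoly {V : zmodType} (m : nat) : (V -> R) -> Prop :=
  annihilated (nseq m setT).

Section Annihilated.
Context {V : zmodType}.
Implicit Types (f g : V -> R) (Ds : seq (set V)).

Lemma fdiffB v f g : fdiff v (fun x => f x - g x) = fun x => fdiff v f x - fdiff v g x.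
Proof. by apply/funext => x; rewrite /fdiff; ring. Qed.

Lemma annihilated0 Ds : annihilated Ds (fun=> 0).
Proof.
elim: Ds => // D Ds IH v _; rewrite (_ : fdiff _ _ = fun=> 0)//.
by apply/funext => x; rewrite /fdiff subrr.
Qed.

Lemma annihilatedB Ds f g : annihilated Ds f -> annihilated Ds g ->
  annihilated Ds (fun x => f x - g x).
Proof.
elim: Ds f g => [|D Ds IH] f g Hf Hg /=; first by move=> x; rewrite Hf Hg subrr.
by move=> v Dv; rewrite fdiffB; apply: IH; [exact: Hf | exact: Hg].
Qed.

Lemma annihilatedD Ds f g : annihilated Ds f -> annihilated Ds g ->
  annihilated Ds (fun x => f x + g x).
Proof.
move=> Hf Hg; have := annihilatedB Hf (annihilatedB (annihilated0 Ds) Hg).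
by under eq_fun do rewrite sub0r opprK.
Qed.

Lemma annihilated_sum Ds (I : eqType) (s : seq I) (F : I -> V -> R) :
  (forall i, i \in s -> annihilated Ds (F i)) ->
  annihilated Ds (fun x => \sum_(i <- s) F i x).
Proof.
elim: s => [|i s IH] Hs.
  by under eq_fun do rewrite big_nil; exact: annihilated0.
under eq_fun do rewrite big_cons.
apply: annihilatedD; first by apply: Hs; rewrite mem_head.
by apply: IH => j js; apply: Hs; rewrite in_cons js orbT.
Qed.

Lemma annihilated_shift Ds f v : annihilated Ds f ->
  annihilated Ds (fun x => f (x + v)).
Proof.
elim: Ds f => [|D Ds IH] f Hf /=; first by move=> x; exact: Hf.
move=> w Dw; have := IH _ (Hf w Dw); rewrite /fdiff.
by under eq_fun do rewrite addrAC.
Qed.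

Lemma annihilated_fdiff Ds f v : annihilated Ds f -> annihilated Ds (fdiff v f).
Proof. by move=> Hf; apply: annihilatedB => //; exact: annihilated_shift. Qed.

End Annihilated.

Lemma gpolyS (V : zmodType) m (f : V -> R) :
  (forall v, gpoly m (fdiff v f)) -> gpoly m.+1 f.
Proof. exact: (fun Hf v _ => Hf v). Qed.

Lemma gpoly_comp (U V : zmodType) (L : U -> V) m (f : V -> R) :
  {morph L : x y / x + y} -> gpoly m f -> gpoly m (f \o L).
Proof.
move=> LD; elim: m f => [|m IH] f Hf /=; first by move=> x; exact: Hf.
move=> v _; rewrite (_ : fdiff v (f \o L) = fdiff (L v) f \o L).
  exact/IH/Hf.
by apply/funext => x; rewrite /fdiff/= LD.
Qed.

End Differences.

(** * Averages along a direction *)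

Section Average.
Local Open Scope classical_set_scope.
Local Open Scope ring_scope.
Context {R : realType} {V : normedModType R}.
Implicit Types (f : V -> R) (b : V).

Definition avg b f (x : V) : R := unit_integral (fun h => f (x + h *: b)).

Lemma line_continuous b (x : V) : continuous (fun h : R => x + h *: b).
Proof.
move=> h; apply: cvgD; first exact: cvg_cst.
by apply: cvgZl; exact: cvg_id.
Qed.

Lemma comp_line_continuous f b x : continuous f ->
  continuous (fun h : R => f (x + h *: b)).
Proof.
move=> cf h; apply: (@continuous_comp _ _ _ (fun h : R => x + h *: b)).
  exact: line_continuous.
exact: cf.
Qed.

Lemma fdiff_continuous f b : continuous f -> continuous (fdiff b f).
Proof.
move=> cf x; apply: cvgB; last exact: cf.
apply: (@continuous_comp _ _ _ (fun x => x + b)); last exact: cf.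
by apply: cvgD; [exact: cvg_id | exact: cvg_cst].
Qed.

(** If F is a primitive of h |-> f (x + h b), the average at x + t b is F (t + 1) - F t. Averaging
    thus gains a derivative along b for a merely continuous f. *)
Lemma is_derive_avg f b x (t : R) : continuous f ->
  is_derive t (1 : R) (fun t => avg b f (x + t *: b)) (fdiff b f (x + t *: b)).
Proof.
move=> cf; have /primitive_exists[F dF] := @comp_line_continuous f b x cf.
have dFs (c u : R) : is_derive u (1 : R) (fun u => F (u + c)) (f (x + (u + c) *: b)).
  have := is_derive1_comp (f := F) (g := shift c) (dF (u + c)) (is_derive_shift u 1 c).
  by rewrite mulr1.
rewrite (_ : (fun t => _) = (fun u => F (u + 1)) - F); last first.
  apply/funext => u; rewrite /avg.
  have dFu h : is_derive h (1 : R) (fun h => F (h + u)) (f (x + u *: b + h *: b)).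
    by rewrite -addrA -scalerDl (addrC u).
  by rewrite (unit_integralE dFu) add0r (addrC 1).
apply: is_derive_eq.
by rewrite /fdiff -addrA scalerDl scale1r.
Qed.

(** Since [0, 1] is compact, f (y + h b) tends to f (x + h b) as y tends to x, uniformly in h. *)
Lemma avg_continuous f b : continuous f -> continuous (avg b f).
Proof.
move=> cf x; apply/cvgrPdist_le => e e0.
have : \forall y \near x, `[0, 1] `<=`
    [set h : R | `|f (x + h *: b) - f (y + h *: b)| <= e].
  have := iffLR (compact_near_coveringP _) (@segment_compact R 0 1).
  apply => h _ /=.
  have c1 : (f (x + z.1 *: b)) @[z --> (nbhs h, nbhs x)] --> f (x + h *: b).
    apply: (@cvg_comp _ _ _ fst (fun h : R => f (x + h *: b)) _ (nbhs h)).
      exact: cvg_fst.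
    exact: comp_line_continuous.
  have c2 : (f (z.2 + z.1 *: b)) @[z --> (nbhs h, nbhs x)] --> f (x + h *: b).
    apply: (@cvg_comp _ _ _ (fun z : R * V => z.2 + z.1 *: b) f _ (nbhs (x + h *: b))).
      apply: cvgD; first exact: cvg_snd.
      by apply: cvgZr_tmp; exact: cvg_fst.
    exact: cf.
  have := cvgB c1 c2; rewrite subrr => c12.
  exact: (iffLR (cvgr0Pnorm_le _) (c12 _) e e0).
apply: filterS => y xy; rewrite /avg -unit_integralB; try exact: comp_line_continuous.
apply: unit_integral_le => [h|h h01].
  by apply: cvgB; exact: comp_line_continuous.
by apply: xy; rewrite /= in_itv/=.
Qed.

Lemma sub_avg_continuous f b : continuous f ->
  continuous (fun x => f x - avg b f x).
Proof. by move=> cf x; apply: cvgB; [exact: cf|exact: avg_continuous]. Qed.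

(** Differences in x commute with integration in h. *)
Lemma annihilated_unit_integral Ds (F : R -> V -> R) :
  (forall x, continuous (F^~ x)) -> (forall h, annihilated Ds (F h)) ->
  annihilated Ds (fun x => unit_integral (F^~ x)).
Proof.
elim: Ds F => [|D Ds IH] F cF HF /=.
  move=> x; rewrite (_ : F^~ x = fun=> 0) ?unit_integral_cst//.
  by apply/funext => h; exact: HF.
move=> v Dv; rewrite (_ : fdiff _ _ = fun x => unit_integral (fun h => fdiff v (F h) x)).
  apply: IH => [x h|h]; last exact: HF.
  by apply: cvgB; exact: cF.
by apply/funext => x; rewrite /fdiff unit_integralB.
Qed.

(** f - M f is minus the integral of Delta_(h b) f over h in [0, 1]. *)
Lemma annihilated_sub_avg Ds f b : continuous f ->
  (forall h : R, annihilated Ds (fdiff (h *: b) f)) ->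
  annihilated Ds (fun x => f x - avg b f x).
Proof.
move=> cf Hf.
rewrite (_ : (fun x => _) =
  fun x => unit_integral (fun h => f x - f (x + h *: b))).
  apply: (@annihilated_unit_integral _ (fun h x => f x - f (x + h *: b))).
    by move=> x h; apply: cvgB; [exact: cvg_cst|exact: comp_line_continuous].
  move=> h; have := annihilatedB (annihilated0 Ds) (Hf h); rewrite /fdiff.
  by under eq_fun do rewrite sub0r opprB.
apply/funext => x; rewrite (@unit_integralB _ (fun=> f x)) ?unit_integral_cst//.
- by move=> h; exact: cvg_cst.
- exact: comp_line_continuous.
Qed.

Lemma line_constant f b : (forall x (t : R),
    is_derive t (1 : R) (fun t => f (x + t *: b)) 0) ->
  forall x (t : R), f (x + t *: b) = f x.
Proof.
by move=> df x t; rewrite (is_derive_cst_eq (df x) t 0) scale0r addr0.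
Qed.

End Average.

(** * Functions of class C^s on the line *)

Section SmoothFunctions.
Local Open Scope classical_set_scope.
Local Open Scope ring_scope.
Context {R : realType}.
Implicit Types f g F G : R -> R.

Lemma is_derive_continuous g G : (forall x, is_derive x (1 : R) G (g x)) ->
  continuous G.
Proof.
by move=> dG x; apply/differentiable_continuous/derivable1_diffP; case: (dG x).
Qed.

Lemma is_derive_big (I : eqType) (s : seq I) (F : I -> R -> R) (dF : I -> R) (t : R) :
  (forall i, i \in s -> is_derive t (1 : R) (F i) (dF i)) ->
  is_derive t (1 : R) (fun t => \sum_(i <- s) F i t) (\sum_(i <- s) dF i).
Proof.
elim: s => [|i s IH] Hs.
  rewrite big_nil; under eq_fun do rewrite big_nil; exact: is_derive_cst.
rewrite big_cons; under eq_fun do rewrite big_cons.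
apply: is_deriveD; first by apply: Hs; rewrite mem_head.
by apply: IH => j js; apply: Hs; rewrite in_cons js orbT.
Qed.

Lemma continuous_sum (T : topologicalType) (I : eqType) (s : seq I)
    (F : I -> T -> R) : (forall i, i \in s -> continuous (F i)) ->
  continuous (fun x => \sum_(i <- s) F i x).
Proof.
elim: s => [|i s IH] Hs x.
  by under eq_fun do rewrite big_nil; exact: cvg_cst.
under eq_fun do rewrite big_cons.
apply: cvgD; first by apply: Hs; rewrite mem_head.
by apply: IH => j js; apply: Hs; rewrite in_cons js orbT.
Qed.

Lemma is_derive_affine g G (a b c t : R) : (forall x, is_derive x (1 : R) G (g x)) ->
  is_derive t (1 : R) (fun t => c * G (a + t * b)) (c * (g (a + t * b) * b)).
Proof.
move=> dG.
have db : is_derive t (1 : R) (fun t : R => a + t * b) b.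
  rewrite (_ : (fun t => _) = cst a + b *: (@id R)); last first.
    by apply/funext => u; rewrite mulrC.
  have := is_deriveD (is_derive_cst a t 1) (is_deriveZ b (is_derive_id t (1 : R))).
  by rewrite add0r [_ *: 1]mulr1.
exact: (@is_deriveZ _ _ _ (G \o (fun t => a + t * b)) c t 1 _
  (is_derive1_comp (f := G) (dG _) db)).
Qed.

Lemma Cdiff1_continuous s g : Cdiff1 s g -> continuous g.
Proof.
case: s => [//|s] [dg _] x.
by apply/differentiable_continuous/derivable1_diffP.
Qed.

Lemma Cdiff1S s g G : (forall x, is_derive x (1 : R) G (g x)) -> Cdiff1 s g ->
  Cdiff1 s.+1 G.
Proof.
move=> dG Cg; split; first by move=> t; case: (dG t).
suff -> : derive1 G = g by [].
by apply/funext => x; rewrite derive1E; apply: derive_val.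
Qed.

Lemma Cdiff1_is_derive s g : Cdiff1 s.+1 g ->
  forall x, is_derive x (1 : R) g (derive1 g x).
Proof. by move=> [dg _] x; rewrite derive1E; exact: derivableP. Qed.

Lemma Cdiff1_cst s (c : R) : Cdiff1 s (fun=> c).
Proof.
elim: s c => [|s IH] c; first by move=> x; exact: cvg_cst.
exact: Cdiff1S (fun x => is_derive_cst c x 1) (IH 0).
Qed.

Lemma Cdiff1D s f g : Cdiff1 s f -> Cdiff1 s g -> Cdiff1 s (fun t => f t + g t).
Proof.
elim: s f g => [|s IH] f g; first by move=> cf cg x; apply: cvgD; [exact: cf|exact: cg].
move=> Cf Cg; apply: (Cdiff1S (g := fun t => derive1 f t + derive1 g t)).
  by move=> x; exact: is_deriveD (Cdiff1_is_derive Cf x) (Cdiff1_is_derive Cg x).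
by apply: IH; [case: Cf|case: Cg].
Qed.

Lemma Cdiff1_scale s (c b : R) g : Cdiff1 s g -> Cdiff1 s (fun t => c * g (t * b)).
Proof.
elim: s c g => [|s IH] c g.
  move=> cg x; apply: cvgM; first exact: cvg_cst.
  apply: (@continuous_comp _ _ _ (fun t : R => t * b) g); last exact: cg.
  by apply: cvgM; [exact: cvg_id|exact: cvg_cst].
move=> Cg; apply: (Cdiff1S (g := fun t => c * b * derive1 g (t * b))).
  move=> x; have := is_derive_affine 0 b c x (Cdiff1_is_derive Cg).
  rewrite add0r mulrA mulrAC; under [X in is_derive _ _ X]eq_fun do rewrite add0r.
  by [].
by apply: IH; case: Cg.
Qed.

(* Averaging over unit intervals splits g into a generalized polynomial of lower
   degree and a primitive of one. *)
Lemma gpoly_Cdiff1 m s g : continuous g -> gpoly m g -> Cdiff1 s g.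
Proof.
elim: m s g => [|m IH] s g cg Hg.
  rewrite (_ : g = fun=> 0); first exact: Cdiff1_cst.
  by apply/funext => x; exact: Hg.
rewrite (_ : g = fun x => (g x - avg (1 : R^o) g x) + avg (1 : R^o) g x); last first.
  by apply/funext => x; rewrite subrK.
apply: Cdiff1D.
  apply: IH; first exact: sub_avg_continuous.
  by apply: annihilated_sub_avg => // h; exact: Hg.
case: s => [|s]; first exact: avg_continuous.
apply: (Cdiff1S (g := fdiff (1 : R^o) g)).
  move=> t; have := @is_derive_avg _ R^o g 1 0 t cg.
  rewrite add0r [_ *: 1]mulr1.
  by under eq_fun do rewrite add0r [_ *: 1]mulr1.
by apply: IH; [exact: fdiff_continuous|exact: Hg].
Qed.

End SmoothFunctions.

(** * Ridge functions on the plane *)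

Section Ridge.
Context {R : realType}.

(** The coefficient of the first coordinate is normalized to 1: independent forms then have distinct
    [l], and differentiating along (1, 0) simply turns g into g'. *)
Definition ridge (l : R) (g : R -> R) (p : R * R) : R := g (p.1 + l * p.2).

Definition level_line (l : R) : set (R * R) := [set v | v.1 + l * v.2 = 0]%classic.

Lemma ridge_continuous l g : continuous g -> continuous (ridge l g).
Proof.
move=> cg p; apply: (@continuous_comp _ _ _ (fun p : R * R => p.1 + l * p.2) g); last first.
  exact: cg.
apply: cvgD; first exact: cvg_fst.
by apply: cvgM; [exact: cvg_cst|exact: cvg_snd].
Qed.

Lemma fdiff_ridge l g v : fdiff v (ridge l g) = ridge l (fdiff (v.1 + l * v.2) g).
Proof.
apply/funext => p; rewrite /fdiff /ridge; congr (g _ - _).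
by rewrite /=; ring.
Qed.

Context {I : eqType}.
Variable lam : I -> R.
Hypothesis lam_inj : injective lam.
Notation levels s := [seq level_line (lam i) | i <- s].

(** A difference of a ridge function is a ridge function of the same slope, and it vanishes when the
    step lies on its level line. This holds for arbitrary g, which is how irregular summands are
    handled. *)
Lemma annihilated_ridge (s : seq I) i g : i \in s ->
  annihilated (levels s) (ridge (lam i) g).
Proof.
elim: s g => // j s IH g; rewrite in_cons => ijs v vj.
rewrite fdiff_ridge; case: eqP ijs => [->|_ /=]; last exact: IH.
rewrite vj (_ : ridge _ _ = fun=> 0); first by move=> _; exact: annihilated0.
by apply/funext => p; rewrite /ridge /fdiff addr0 subrr.
Qed.

(** Each level line contains vectors of every second coordinate, so on a function of [p.2] alone its
    differences are arbitrary ones. *)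
Lemma gpoly_levels (s : seq I) (r : R -> R) :
  annihilated (levels s) (fun p => r p.2) -> gpoly (size s) r.
Proof.
elim: s r => [|j s IH] r Hr; first by move=> x; exact: (Hr (0, x)).
move=> v _; apply: IH; apply: (Hr (- (lam j * v), v)).
by rewrite /level_line /= addNr.
Qed.

(* Differences along the level line of the ridge function H j remove it and turn
   every other H i into one of its differences. *)
Lemma ridge_gpoly (s : seq I) m i (H : I -> R -> R) (r : R * R -> R) :
  i \notin s ->
  (forall p, ridge (lam i) (H i) p + \sum_(j <- s) ridge (lam j) (H j) p = r p) ->
  gpoly m r -> gpoly (size s + m) (H i).
Proof.
elim: s H r => [|j s IH] H r.
  move=> _ Hr gr; rewrite add0n.
  (* On the axis [p.2 = 0] the remaining ridge function is [H i] itself. *)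
  rewrite (_ : H i = r \o (fun x => (x, 0))).
    by apply: gpoly_comp gr => x y; congr (_, _); rewrite addr0.
  by apply/funext => x; rewrite /= -Hr big_nil addr0 /ridge/= mulr0 addr0.
rewrite in_cons negb_or => /andP[ij iNs] Hr gr; rewrite [size _]/= addSn; apply: gpolyS => v.
have lij : lam i - lam j != 0 by rewrite subr_eq0; apply: contra ij => /eqP/lam_inj->.
(* The step [w] lies on the level line of [lam j] and moves the argument of [H i] by exactly [v]. *)
pose t := v / (lam i - lam j); pose w := (- (lam j * t), t).
have wj : w.1 + lam j * w.2 = 0 by rewrite /= addNr.
have wi : w.1 + lam i * w.2 = v.
  by rewrite /= /t; field.
rewrite -wi.
apply: (IH (fun k => fdiff (w.1 + lam k * w.2) (H k)) (fdiff w r)) => //.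
  move=> p; rewrite -fdiff_ridge.
  under eq_bigr do rewrite -fdiff_ridge.
  rewrite [RHS]/fdiff -!Hr !big_cons /fdiff sumrB.
  have -> : ridge (lam j) (H j) (p + w) = ridge (lam j) (H j) p.
    rewrite /ridge; congr (H j _).
    by move: wj => /=; lra.
  by ring.
exact: annihilated_fdiff.
Qed.

(** Both f - M f and Delta_b f satisfy the equation without the factor of [lam i0], so by induction
    they are ridge sums over [s]. Integrating the second along b recovers M f up to a function
    constant along b, which is a ridge function of slope [lam i0]. *)
Lemma planar_continuous (s : seq I) (f : R * R -> R) : uniq s ->
  continuous f -> annihilated (levels s) f ->
  exists g : I -> R -> R, (forall i, continuous (g i)) /\
    forall p, f p = \sum_(i <- s) ridge (lam i) (g i) p.
Proof.
elim: s f => [|i0 s IH] f /=.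
  move=> _ _ f0; exists (fun _ _ => 0); split => [i x|p]; first exact: cvg_cst.
  by rewrite big_nil.
move=> /andP[i0s us] cf Hf; pose b : R * R := (- lam i0, 1).
have Hfb (h : R) : annihilated (levels s) (fdiff (h *: b) f).
  by apply: Hf; rewrite /level_line /=; rewrite [_ *: 1]mulr1 [_ *: _]mulrN mulrC addNr.
have [|g1 [cg1 g1E]] := IH _ us _ (annihilated_sub_avg cf Hfb).
  exact: sub_avg_continuous.
have [|g2 [cg2 g2E]] := IH _ us _ (Hfb 1); first exact: fdiff_continuous.
have /choice[G dG] : forall i, exists G, forall x, is_derive x (1 : R) G (g2 i x).
  by move=> i; exact: primitive_exists.
(* Moving by t b changes x + lam_i y by t (lam_i - lam_i0); the factor cancels what the chain rule
   produces. *)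
pose h i x := (lam i - lam i0)^-1 * G i x.
have ch i : continuous (h i).
  by move=> x; apply: cvgM; [exact: cvg_cst|exact: (is_derive_continuous (dG i))].
pose r p := avg b f p - \sum_(i <- s) ridge (lam i) (h i) p.
have cr : continuous r.
  move=> p; apply: cvgB; first exact: avg_continuous.
  by apply: continuous_sum => i _; exact: ridge_continuous.
have rb p (t : R) : r (p + t *: b) = r p.
  apply: line_constant => {}p {}t.
  rewrite [X in is_derive _ _ _ X](_ : 0 = fdiff b f (p + t *: b) -
    \sum_(i <- s) (lam i - lam i0)^-1 *
      (g2 i (p.1 + lam i * p.2 + t * (lam i - lam i0)) * (lam i - lam i0))).
    apply: is_deriveB; first exact: is_derive_avg.
    apply: is_derive_big => i _.
    have := is_derive_affine (p.1 + lam i * p.2) (lam i - lam i0) (lam i - lam i0)^-1 t (dG i).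
    congr (is_derive _ _ _ _); apply/funext => u.
    rewrite /ridge /h /=; congr (_ * G i _); rewrite [_ *: 1]mulr1 [_ *: _]mulrN; ring.
  rewrite -[b in fdiff b]scale1r g2E -sumrB big1_seq// => i /= si.
  have l0 : lam i - lam i0 != 0.
    by rewrite subr_eq0; apply: contraNneq i0s => /lam_inj <-.
  rewrite [X in _ - X]mulrC mulfK// /ridge; apply/eqP; rewrite subr_eq0; apply/eqP.
  congr (g2 i _).
  by rewrite /= [_ *: 1]mulr1 [_ *: _]mulrN; ring.
(* Being constant along b, [r] is determined by its values on the axis [p.2 = 0]. For the other
   indices, [g1] comes from f - M f and [h] from M f. *)
exists (fun i => if i == i0 then fun x => r (x, 0) else fun x => g1 i x + h i x); split.
  move=> i; case: eqP => _ x.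
    apply: (@continuous_comp _ _ _ (fun x : R => (x, 0 : R)) r); last exact: cr.
    by apply: (@cvg_pair _ _ _ _ (nbhs x) (nbhs (0 : R))); [exact: cvg_id|exact: cvg_cst].
  by apply: cvgD; [exact: cg1|exact: ch].
move=> p; rewrite big_cons eqxx.
have -> : \sum_(j <- s) ridge (lam j) (if j == i0 then fun x => r (x, 0)
      else fun x => g1 j x + h j x) p =
    \sum_(j <- s) ridge (lam j) (g1 j) p + \sum_(j <- s) ridge (lam j) (h j) p.
  rewrite -big_split; apply: eq_big_seq => j js /=.
  by case: eqP js i0s => [->->//|_ _ _]; rewrite /ridge.
rewrite -g1E {1}/ridge -[r (_, _)](rb _ p.2).
have -> : (p.1 + lam i0 * p.2, 0) + p.2 *: b = p.
  case: p => x y; rewrite /b /=; congr (_, _); rewrite /=.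
    by rewrite [_ *: _]mulrN; ring.
  by rewrite [_ *: _]mulr1 add0r.
by rewrite /r; ring.
Qed.

End Ridge.

(** * Directional derivatives *)

Section DirectionalDerivatives.
Local Open Scope classical_set_scope.
Local Open Scope ring_scope.
Context {R : realType}.

Section NormedModule.
Context {V : normedModType R}.
Implicit Types (f : V -> R) (u v x : V).

Lemma cvg_is_derive f x v (d : R) :
  h^-1 *: (f (h *: v + x) - f x) @[h --> 0^'] --> d -> is_derive x v f d.
Proof.
by move=> fd; apply: DeriveDef; [exact: cvgP fd|exact: (cvg_lim (@Rhausdorff R) fd)].
Qed.

Lemma is_derive_cvg f x v (d : R) : is_derive x v f d ->
  h^-1 *: (f (h *: v + x) - f x) @[h --> 0^'] --> d.
Proof. by case=> fx <-. Qed.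

Lemma is_derive_line f x v (t : R) : derivable f (x + t *: v) v ->
  is_derive t (1 : R) (fun t => f (x + t *: v)) ('D_v f (x + t *: v)).
Proof.
move=> df.
have E : (fun h : R => h^-1 *: (((fun t => f (x + t *: v)) \o shift t) (h *: 1) -
      f (x + t *: v))) =
    (fun h : R => h^-1 *: ((f \o shift (x + t *: v)) (h *: v) - f (x + t *: v))).
  by apply/funext => h /=; rewrite [h%:A]mulr1 addrCA -scalerDl.
by apply: DeriveDef; rewrite /derivable/derive E.
Qed.

Lemma derivative_shift f x v w : derivable f (x + w) v ->
  derivable (fun x => f (x + w)) x v /\ 'D_v (fun x => f (x + w)) x = 'D_v f (x + w).
Proof.
have E : (fun h : R => h^-1 *: (((fun x => f (x + w)) \o shift x) (h *: v) - f (x + w))) =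
    (fun h : R => h^-1 *: ((f \o shift (x + w)) (h *: v) - f (x + w))).
  by apply/funext => h /=; rewrite addrA.
by rewrite /derivable /derive E.
Qed.

(** Differentiation commutes with differences. *)
Lemma annihilated_derive (Ds : seq (set V)) f u : (forall x, derivable f x u) ->
  annihilated Ds f -> annihilated Ds (fun x => 'D_u f x).
Proof.
elim: Ds f => [|D Ds IH] f df Hf /=.
  move=> x; rewrite (_ : f = cst 0) ?derive_cst//.
  by apply/funext => y; exact: Hf.
move=> v Dv; rewrite (_ : fdiff v _ = fun x => 'D_u (fdiff v f) x); last first.
  apply/funext => x; have [d1 d2] := derivative_shift (df (x + v)).
  by rewrite [RHS](deriveB d1 (df x)) d2.
apply: IH; last exact: Hf.
by move=> x; apply: derivableB => //; case: (derivative_shift (df (x + v))).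
Qed.

(** Rescaling the segment to [0, 1] treats both signs of t, and t = 0, at once. *)
Lemma mvt_line f y v (t : R) : (forall x, derivable f x v) ->
  exists2 c : R, 0 <= c <= 1 & f (y + t *: v) - f y = t * 'D_v f (y + (c * t) *: v).
Proof.
move=> df; pose phi (s : R) := f (y + s *: v).
have dphi s : is_derive s (1 : R) phi ('D_v f (y + s *: v)) by exact: is_derive_line.
have dphit s : is_derive s (1 : R) (fun s => 1 * phi (0 + s * t))
    (1 * ('D_v f (y + (0 + s * t) *: v) * t)).
  exact: (is_derive_affine 0 t 1 s dphi).
have [|c c01] := MVT ltr01 (fun s _ => dphit s).
  exact/continuous_subspaceT/(is_derive_continuous dphit).
rewrite /phi !mul1r !add0r mul0r scale0r addr0 subr0 mulr1 => E.
exists c; last by rewrite E mulrC.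
by move: c01; rewrite in_itv/= => /andP[? ?]; rewrite !ltW.
Qed.

(** The increment along h (v + c w) is the one along h v followed by one along h c w. By the mean
    value theorem the latter is h c times D_w f at a point tending to x, where D_w f is
    continuous. *)
Lemma is_deriveD_dir f x v w (c d : R) :
  (forall y, derivable f y w) -> {for x, continuous (fun y => 'D_w f y)} ->
  is_derive x v f d -> is_derive x (v + c *: w) f (d + c * 'D_w f x).
Proof.
move=> dw cw /is_derive_cvg fd; apply: cvg_is_derive.
have -> : (fun h : R => h^-1 *: (f (h *: (v + c *: w) + x) - f x)) =
    (fun h => h^-1 *: (f (h *: v + x) - f x)) +
    (fun h => h^-1 *: (f (h *: v + x + (h * c) *: w) - f (h *: v + x))).
  apply/funext => h.
  rewrite -[RHS]/(_ + _) -scalerDr; congr (_ *: _).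
  rewrite scalerDr scalerA (addrAC (h *: v)); ring.
apply: cvgD => //; apply/cvgrPdist_le => e e0.
(* The added 1 covers the case c = 0. *)
have e1 : 0 < e / (`|c| + 1) by rewrite divr_gt0// ltr_wpDl.
move/cvgrPdist_le : cw => /(_ _ e1)/nbhs_ballP[r /= r0 rP].
near=> h.
have h0 : h != 0 by near: h; exact: nbhs_dnbhs_neq.
have [t t01 ->] := mvt_line (h *: v + x) (h * c) dw.
set d' := 'D_w f (_ + (t * _) *: w); rewrite [X in _ - X](_ : _ = c * d'); last first.
  by change (h^-1 * (h * c * d') = c * d'); field.
rewrite -mulrBr normrM.
rewrite (@le_trans _ _ (`|c| * (e / (`|c| + 1))))//; last first.
  rewrite mulrCA ler_piMr// ?(ltW e0)// ler_pdivrMr ?ltr_wpDl// mul1r.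
  by rewrite lerDl.
rewrite ler_wpM2l//; apply: rP.
rewrite -ball_normE /=.
have -> : x - (h *: v + x + (t * (h * c)) *: w) = - (h *: (v + (t * c) *: w)).
  rewrite scalerDr scalerA mulrCA; rewrite (addrC _ x) -addrA opprD addrA subrr.
  by rewrite add0r.
rewrite normrN normrZ.
have K0 : 0 < `|v| + `|c| * `|w| + 1 by rewrite ltr_wpDl// addr_ge0// mulr_ge0.
apply: (@le_lt_trans _ _ (`|h| * (`|v| + `|c| * `|w| + 1))).
  rewrite ler_wpM2l// (le_trans (ler_normD _ _))// -addrA lerD2l.
  rewrite normrZ normrM (le_trans _ (_ : `|c| * `|w| <= _)) ?lerDl//.
  rewrite ler_wpM2r// ler_piMl//.
  by case/andP: t01 => t0 t1; rewrite ger0_norm.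
rewrite -ltr_pdivlMr//; near: h.
by apply: dnbhs0_lt; rewrite divr_gt0.
Unshelve. all: by end_near. Qed.

End NormedModule.

Lemma is_derive_partials n (f : 'rV[R]_n -> R) (u x : 'rV[R]_n) :
  (forall i y, derivable f y (delta_mx 0 i)) ->
  (forall i, continuous (fun y => 'D_(delta_mx 0 i) f y)) ->
  is_derive x u f (\sum_i u 0 i * 'D_(delta_mx 0 i) f x).
Proof.
move=> df cf; rewrite [u in is_derive _ u]row_sum_delta.
elim: (index_enum _) => [|i s IH].
  by rewrite !big_nil; exact: is_derive0.
rewrite !big_cons addrC [X in is_derive _ _ _ X]addrC.
by apply: is_deriveD_dir => //; exact: cf.
Qed.

Lemma continuousZD (T : topologicalType) (c : R) (f g : T -> R) :
  continuous f -> continuous g -> continuous (fun x => c * f x + g x).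
Proof.
move=> cf cg x; apply: cvgD; last exact: cg.
by apply: cvgM; [exact: cvg_cst|exact: cf].
Qed.

(** Regularity along one direction, each derivative being continuous on the whole space. The planar
    argument differentiates along (1, 0) only, so C^s enters it in this form. *)
Fixpoint Cdir {V : normedModType R} (s : nat) (u : V) (f : V -> R) : Prop :=
  if s is s'.+1 then
    [/\ continuous f, forall x, derivable f x u & Cdir s' u (fun x => 'D_u f x)]
  else continuous f.

Lemma Cdiff_continuous n s (f : 'rV[R]_n -> R) : Cdiff s f -> continuous f.
Proof. by case: s => [|s] // []. Qed.

Lemma Cdiff0 n s : Cdiff s ((fun=> 0) : 'rV[R]_n -> R).
Proof.
elim: s => [|s IH]; first exact: cst_continuous.
split=> [|i]; first exact: cst_continuous.
split=> [x|]; first exact: derivable_cst.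
by under eq_fun do rewrite derive_cst.
Qed.

Lemma CdiffZD n s (c : R) (f g : 'rV[R]_n -> R) : Cdiff s f -> Cdiff s g ->
  Cdiff s (fun x => c * f x + g x).
Proof.
elim: s f g => [|s IH] f g Cf Cg.
  exact: continuousZD.
case: Cf Cg => cf Df [cg Dg]; split; first exact: continuousZD.
move=> i; have [[dfi Dfi] [dgi Dgi]] := (Df i, Dg i); split.
  by move=> x; apply: derivableD => //; exact: derivableZ.
rewrite (_ : (fun x => _) =
  fun x => c * 'D_(delta_mx 0 i) f x + 'D_(delta_mx 0 i) g x); first exact: IH.
apply/funext => x; rewrite [LHS]deriveD//; last exact: derivableZ.
by rewrite deriveZ.
Qed.

(** D_u f is a linear combination of the partial derivatives, so it keeps the regularity they
    have. *)
Lemma Cdiff_Cdir n s (u : 'rV[R]_n) f : Cdiff s f -> Cdir s u f.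
Proof.
elim: s f => [//|s IH] f [cf Df].
have du x := is_derive_partials u x (fun i => (Df i).1)
  (fun i => Cdiff_continuous (Df i).2).
split; [exact: cf|by move=> x; case: (du x)|apply: IH].
rewrite (_ : (fun x => _) =
  fun x => \sum_i u 0 i * 'D_(delta_mx 0 i) f x); last first.
  by apply/funext => x; exact: derive_val.
elim: (index_enum _) => [|i r IHr].
  by under eq_fun do rewrite big_nil; exact: Cdiff0.
by under eq_fun do rewrite big_cons; apply: CdiffZD => //; exact: (Df i).2.
Qed.

(** L carries lines along e to lines along u with the same parameter, so the difference quotients
    coincide. *)
Lemma Cdir_comp (U V : normedModType R) (L : U -> V) s (e : U) (u : V) f :
  continuous L -> (forall h x, L (h *: e + x) = h *: u + L x) ->
  Cdir s u f -> Cdir s e (f \o L).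
Proof.
move=> cL Le; elim: s f => [|s IH] f.
  by move=> cf x; apply: continuous_comp; [exact: cL|exact: cf].
have E x : (fun h : R => h^-1 *: (((f \o L) \o shift x) (h *: e) - (f \o L) x)) =
    (fun h : R => h^-1 *: ((f \o shift (L x)) (h *: u) - f (L x))).
  by apply/funext => h /=; rewrite Le.
move=> [cf df Df]; split.
- by move=> x; apply: continuous_comp; [exact: cL|exact: cf].
- by move=> x; rewrite /derivable E; exact: df.
- rewrite (_ : (fun x => _) = (fun y => 'D_u f y) \o L); first exact: IH.
  by apply/funext => x; rewrite /derive E.
Qed.

End DirectionalDerivatives.

(** * Ridge sums of class C^k on the plane *)

Section PlanarSmooth.
Local Open Scope classical_set_scope.
Local Open Scope ring_scope.
Context {R : realType} {I : eqType}.
Variable lam : I -> R.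
Hypothesis lam_inj : injective lam.

Lemma planar_smooth k (s : seq I) (f : R * R -> R) : uniq s ->
  Cdir k ((1, 0) : R * R) f ->
  annihilated [seq level_line (lam i) | i <- s] f ->
  exists g : I -> R -> R, (forall i, Cdiff1 k (g i)) /\
    forall p, f p = \sum_(i <- s) ridge (lam i) (g i) p.
Proof.
elim: k f => [|k IH] f us; first exact: planar_continuous.
move=> [cf df Df] Hf; pose e : R * R := (1, 0).
have [g [Cg gE]] := IH _ us Df (annihilated_derive df Hf).
have /choice[G dG] : forall i, exists G, forall x, is_derive x (1 : R) G (g i x).
  by move=> i; apply: primitive_exists; exact: Cdiff1_continuous (Cg i).
(* The error after integrating the decomposition of D_e f: it is constant along e and satisfies the
   same difference equation as f. *)
pose r p := f p - \sum_(i <- s) ridge (lam i) (G i) p.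
have cr : continuous r.
  move=> p; apply: cvgB; first exact: cf.
  apply: continuous_sum => i _; apply: ridge_continuous.
  exact: is_derive_continuous (dG i).
have Hr : annihilated [seq level_line (lam i) | i <- s] r.
  apply: annihilatedB => //; apply: annihilated_sum => i si.
  exact: annihilated_ridge.
have re p (t : R) : r (p + t *: e) = r p.
  apply: line_constant => {}p {}t.
  rewrite [X in is_derive _ _ _ X](_ : 0 = 'D_e f (p + t *: e) -
    \sum_(i <- s) 1 * (g i (p.1 + lam i * p.2 + t * 1) * 1)).
    apply: is_deriveB; first exact: is_derive_line.
    apply: is_derive_big => i _.
    have := is_derive_affine (p.1 + lam i * p.2) 1 1 t (dG i).
    congr (is_derive _ _ _ _); apply/funext => u.
    by rewrite /ridge mul1r /= [_ *: 1]mulr1 [_ *: 0]mulr0; congr (G i _); ring.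
  rewrite gE -sumrB big1_seq// => i _.
  rewrite mul1r mulr1 /ridge /= [_ *: 1]mulr1 [_ *: 0]mulr0; apply/eqP.
  by rewrite subr_eq0; apply/eqP; congr (g i _); ring.
have r2 p : r p = r (0, p.2).
  rewrite -[RHS](re _ p.1); congr r; apply/esym; case: p => x y; rewrite /e /=.
  by congr (_, _); rewrite /= ?[_ *: 1]mulr1 ?[_ *: 0]mulr0 ?add0r ?addr0.
have [rho [crho rhoE]] := planar_continuous lam_inj us cr Hr.
have gr : gpoly (size s) r.
  have : gpoly (size s) (fun y : R => r (0, y)).
    apply: gpoly_levels (lam) _ _ _.
    by rewrite (_ : (fun p => _) = r)//; apply/funext => p; rewrite [RHS]r2.
  move=> /(@gpoly_comp _ (R * R)%type _ snd); rewrite (_ : _ \o snd = r).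
    by apply.
  by apply/funext => p; rewrite [RHS]r2.
(* The [rho i] are so far only continuous. Their ridge sum is the generalized polynomial [r], so
   each is a generalized polynomial and hence smooth. *)
have Crho i : i \in s -> Cdiff1 k.+1 (rho i).
  move=> si; apply: (@gpoly_Cdiff1 _ (size (rem i s) + size s)); first exact: crho.
  apply: (ridge_gpoly lam_inj _ _ gr (s := rem i s) (i := i)).
    by rewrite mem_rem_uniqF.
  by move=> p; rewrite rhoE [RHS](big_rem i).
(* Outside [s] nothing is known of [rho i], and the value 0 keeps the family smooth. *)
exists (fun i => if i \in s then fun x => G i x + rho i x else fun=> 0); split.
  move=> i; case: ifPn => [/Crho Ci|_]; last exact: Cdiff1_cst.
  by apply: Cdiff1D => //; exact: Cdiff1S (dG i) (Cg i).
move=> p; rewrite -[LHS](subrK (\sum_(i <- s) ridge (lam i) (G i) p)).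
rewrite -[X in X + _]/(r p) rhoE -big_split; apply: eq_big_seq => i si /=.
by rewrite si /ridge addrC.
Qed.

End PlanarSmooth.

(** * Frechet's theorem *)

Section Frechet.
Local Open Scope classical_set_scope.
Local Open Scope ring_scope.
Context {R : realType} {n : nat}.
Implicit Types (r q : 'rV[R]_n -> R) (x : 'rV[R]_n) (i : 'I_n).

(** The degree is less than [d], the convention of [gpoly]; [d = 0] leaves only the zero
    function. *)
Definition polyfun (d : nat) r : Prop := exists P : mpoly n R,
  (mmeasure mdeg P <= d)%N /\ forall x, r x = evalp P x.

Definition monomial (m : multinom n) x : R := \prod_i x 0 i ^+ m i.

Lemma polyfun0 d : polyfun d (fun=> 0).
Proof. by exists 0; split=> [|x]; rewrite ?mmeasure0// /evalp meval0. Qed.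

Lemma polyfunD d r q : polyfun d r -> polyfun d q -> polyfun d (fun x => r x + q x).
Proof.
move=> [P [dP rP]] [Q [dQ qQ]]; exists (P + Q); split=> [|x].
  by rewrite (leq_trans (mmeasureD_le _ _ _))// geq_max dP dQ.
by rewrite rP qQ /evalp mevalD.
Qed.

Lemma polyfunZ d (c : R) r : polyfun d r -> polyfun d (fun x => c * r x).
Proof.
move=> [P [dP rP]]; exists (c *: P); split=> [|x].
  exact: leq_trans (mmeasureZ_le _ _ _) dP.
by rewrite rP /evalp mevalZ.
Qed.

Lemma polyfunB d r q : polyfun d r -> polyfun d q -> polyfun d (fun x => r x - q x).
Proof.
move=> pr pq; have := polyfunD pr (polyfunZ (-1) pq).
by under eq_fun do rewrite mulN1r.
Qed.

Lemma polyfunW d e r : (d <= e)%N -> polyfun d r -> polyfun e r.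
Proof. by move=> de [P [dP rP]]; exists P; split=> //; exact: leq_trans de. Qed.

Lemma polyfun_monomial d m : (mdeg m < d)%N -> polyfun d (monomial m).
Proof.
move=> md; exists (mpolyX R m); split=> [|x]; first by rewrite mmeasureX.
by rewrite /evalp mevalX.
Qed.

Lemma polyfun_ind d (K : ('rV[R]_n -> R) -> Prop) : K (fun=> 0) ->
  (forall c m r, (mdeg m < d)%N -> K r -> K (fun x => c * monomial m x + r x)) ->
  forall r, polyfun d r -> K r.
Proof.
move=> K0 KD r [P [dP rP]].
have -> : r = fun x => \sum_(m <- msupp P) mcoeff m P * monomial m x.
  apply/funext => x; rewrite rP {1}(mpolyE P) /evalp raddf_sum/=.
  by apply: eq_bigr => m _; rewrite mevalZ mevalX.
have : {in msupp P, forall m, (mdeg m < d)%N}.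
  by move=> m mP; apply: leq_trans dP; exact: msize_mdeg_lt.
elim: (msupp P) => [|m s IH] Hs.
  by under eq_fun do rewrite big_nil.
under eq_fun do rewrite big_cons; apply: KD; first by apply: Hs; rewrite mem_head.
by apply: IH => m' m's; apply: Hs; rewrite in_cons m's orbT.
Qed.

Definition zero_coord i x : 'rV[R]_n := x - x 0 i *: delta_mx 0 i.

Lemma zero_coordE i x j : zero_coord i x 0 j = if j == i then 0 else x 0 j.
Proof.
rewrite !mxE eqxx /=; case: eqP => [->|_]; first by rewrite mulr1 subrr.
by rewrite mulr0 subr0.
Qed.

(** Putting x_i = 0 kills the monomials that contain x_i and fixes the others. *)
Lemma polyfun_zero_coord d i r : polyfun d r -> polyfun d (r \o zero_coord i).
Proof.
move: r; apply: polyfun_ind; first exact: polyfun0.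
move=> c m r md Kr; apply: polyfunD => //; apply: polyfunZ.
have [mi0|mi0] := eqVneq (m i) 0%N.
  rewrite (_ : (fun x => _) = monomial m); first exact: polyfun_monomial.
  apply/funext => x; apply: eq_bigr => j _; rewrite zero_coordE.
  by case: eqP => // ->; rewrite mi0 !expr0.
rewrite (_ : (fun x => _) = fun=> 0); first exact: polyfun0.
apply/funext => x; rewrite /monomial (bigD1 i)//= zero_coordE eqxx expr0n.
by rewrite (negbTE mi0) mul0r.
Qed.

Lemma polyfun_primitive d i r : polyfun d r -> exists2 q, polyfun d.+1 q &
  forall x (t : R), is_derive t (1 : R)
    (fun t => q (x + t *: delta_mx 0 i)) (r (x + t *: delta_mx 0 i)).
Proof.
move: r; apply: polyfun_ind.
  by exists (fun=> 0); [exact: polyfun0|move=> x t; exact: is_derive_cst].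
move=> c m r md [q pq dq].
(* The primitive of c x^m in the variable x_i is c / (m_i + 1) times x_i x^m. *)
pose b : R := c / (m i).+1%:R.
exists (fun x => b * monomial (mnm_add m (mnm1 i)) x + q x).
  apply: polyfunD => //; apply/polyfunZ/polyfun_monomial.
  by rewrite mdegD mdeg1 addn1 ltnS.
move=> x t; apply: (is_deriveD _ (dq x t)).
pose B := \prod_(j | j != i) x 0 j ^+ m j.
have xE u j : (x + u *: delta_mx 0 i) 0 j = if j == i then x 0 i + u else x 0 j.
  rewrite !mxE eqxx /=; case: eqP => [->|_]; first by rewrite mulr1.
  by rewrite mulr0 addr0.
have -> : (fun t => b * monomial (mnm_add m (mnm1 i)) (x + t *: delta_mx 0 i)) =
    fun t : R => (b * B) * (fun t => t ^+ (m i).+1) (x 0 i + t * 1).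
  apply/funext => u; rewrite /monomial (bigD1 i)//= xE eqxx mnmDE mnm1E eqxx addn1 mulr1.
  rewrite (eq_bigr (fun j => x 0 j ^+ m j)) 1?mulrA 1?mulrAC// => j ji.
  by rewrite xE (negbTE ji) mnmDE mnm1E eq_sym (negbTE ji) addn0.
have := @is_derive_affine R (fun t => (m i).+1%:R * t ^+ m i) (fun t => t ^+ (m i).+1)
  (x 0 i) 1 (b * B) t.
rewrite (_ : b * B * _ = c * monomial m (x + t *: delta_mx 0 i)).
  apply => y; apply: DeriveDef; first exact: exprn_derivable.
  by rewrite exp_derive /= [_ *: 1]mulr1.
rewrite /monomial (bigD1 i)//= xE eqxx !mulr1.
rewrite [in RHS](eq_bigr (fun j => x 0 j ^+ m j)); last first.
  by move=> j ji; rewrite xE (negbTE ji).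
rewrite -/B /b; field.
by rewrite addrC natr1 pnatr_eq0.
Qed.

(** By the assumption for m, f - M f and Delta_e f are polynomials. With q a polynomial primitive of
    Delta_e f along e, M f - q is constant along e and cancels when x_i is replaced by 0. *)
Lemma gpoly_sub_zero_coord m i (f : 'rV[R]_n -> R) :
  (forall g : 'rV[R]_n -> R, continuous g -> gpoly m g -> polyfun m g) ->
  continuous f -> gpoly m.+1 f -> polyfun m.+1 (fun x => f x - f (zero_coord i x)).
Proof.
move=> IH cf Hf; pose e : 'rV[R]_n := delta_mx 0 i.
have p1 : polyfun m (fun x => f x - avg e f x).
  apply: IH; first exact: sub_avg_continuous.
  by apply: annihilated_sub_avg => // h; exact: Hf.
have /(polyfun_primitive i)[q pq dq] : polyfun m (fdiff e f).
  by apply: IH; [exact: fdiff_continuous|exact: Hf].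
pose h x := avg e f x - q x.
have he x (t : R) : h (x + t *: e) = h x.
  apply: line_constant => {}x {}t.
  rewrite -[X in is_derive _ _ _ X](subrr (fdiff e f (x + t *: e))).
  by apply: is_deriveB; exact: is_derive_avg.
have -> : (fun x => f x - f (zero_coord i x)) =
    fun x => ((f x - avg e f x) + q x) -
             ((f (zero_coord i x) - avg e f (zero_coord i x)) + q (zero_coord i x)).
  apply/funext => x; have := he x (- x 0 i).
  by rewrite scaleNr -/(zero_coord i x) /h; lra.
have pr : polyfun m.+1 (fun x => f x - avg e f x + q x).
  by apply: polyfunD => //; exact: polyfunW p1.
exact: polyfunB pr (polyfun_zero_coord i pr).
Qed.

(** Setting the coordinates to 0 one after another writes f - f 0 as a telescoping sum of
    polynomials. *)
Lemma frechet m (f : 'rV[R]_n -> R) : continuous f -> gpoly m f -> polyfun m f.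
Proof.
elim: m f => [|m IH] f cf Hf.
  by rewrite (_ : f = fun=> 0); [exact: polyfun0|apply/funext => x; exact: Hf].
have p1 i : polyfun m.+1 (fun x => f x - f (zero_coord i x)).
  exact: gpoly_sub_zero_coord.
pose Z s x := foldl (fun x i => zero_coord i x) x s.
have ps s : polyfun m.+1 (fun x => f x - f (Z s x)).
  elim: s => [|i s IHs] /=.
    by under eq_fun do rewrite subrr; exact: polyfun0.
  have := polyfunD (p1 i) (polyfun_zero_coord i IHs).
  by under eq_fun do rewrite addrA subrK.
have ZE s x j : Z s x 0 j = if j \in s then 0 else x 0 j.
  elim: s x => //= i s IHs x; rewrite IHs zero_coordE in_cons.
  by case: (j \in s); rewrite ?orbT ?orbF.
have -> : f = fun x => (f x - f (Z (enum 'I_n) x)) + f 0 * monomial (@mnm0 n) x.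
  apply/funext => x; rewrite (_ : Z _ x = 0).
    rewrite /monomial big1 ?mulr1 ?subrK// => i _.
    by rewrite mnm0E expr0.
  by apply/rowP => j; rewrite ZE mem_enum mxE.
by apply: polyfunD => //; apply/polyfunZ/polyfun_monomial; rewrite mdeg0.
Qed.

End Frechet.

(** * The generic plane *)

Section GenericPlane.
Context {R : realType} {n : nat}.
Implicit Types (a b x : 'rV[R]_n).

Lemma dotpD a x y : dotp a (x + y) = dotp a x + dotp a y.
Proof. by rewrite /dotp -big_split; apply: eq_bigr => i _; rewrite mxE mulrDr. Qed.

Lemma dotpZ a (c : R) x : dotp a (c *: x) = c * dotp a x.
Proof. by rewrite /dotp mulr_sumr; apply: eq_bigr => i _; rewrite mxE mulrCA. Qed.

Lemma dotpBl a b x : dotp (a - b) x = dotp a x - dotp b x.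
Proof. by rewrite /dotp -sumrB; apply: eq_bigr => i _; rewrite !mxE mulrBl. Qed.

Lemma dotpZl (c : R) a x : dotp (c *: a) x = c * dotp a x.
Proof. by rewrite /dotp mulr_sumr; apply: eq_bigr => i _; rewrite mxE mulrA. Qed.

Lemma dotp0l x : dotp 0 x = 0.
Proof. by rewrite /dotp big1// => i _; rewrite mxE mul0r. Qed.

Lemma dotp_continuous a : continuous (dotp a).
Proof.
apply: continuous_sum => i _ x.
apply: (continuous_comp (@coord_continuous R 1 n 0 i x)).
exact: mulrl_continuous.
Qed.

(* The moment curve t |-> (1, t, ..., t^(n-1)) meets each hyperplane in finitely
   many points. *)
Lemma avoid_hyperplanes (ws : seq 'rV[R]_n) : 0 \notin ws ->
  exists v, forall w, w \in ws -> dotp w v != 0.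
Proof.
move=> w0; pose P : {poly R} := \prod_(w <- ws) rVpoly w.
have P0 : P != 0.
  rewrite prodf_seq_neq0; apply/allP => w ww /=.
  by by apply: contraNneq w0 => E; rewrite (_ : 0 = w)// -[w]rVpolyK E linear0.
(* A nonzero P has fewer than [size P] roots, so one of these [size P] numbers is not a root. *)
pose rs : seq R := [seq i%:R | i <- iota 0 (size P)].
have urs : uniq rs.
  by rewrite map_inj_uniq ?iota_uniq// => i j /eqP; rewrite eqr_nat => /eqP.
have /allPn[t _ Pt] : ~~ all (root P) rs.
  apply/negP => /(max_poly_roots P0)/(_ urs).
  by rewrite size_map size_iota ltnn.
exists (\row_i t ^+ i) => w ww.
have -> : dotp w (\row_i t ^+ i) = (rVpoly w).[t].
  rewrite (horner_coef_wide _ (size_poly _ _)).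
  by apply: eq_bigr => i _; rewrite mxE coef_rVpoly_ord.
apply: contraNneq Pt => wt0.
by rewrite /root horner_prod (big_rem w)//= wt0 mul0r.
Qed.

(** Shows that the hyperplanes to be avoided by the second generic vector have nonzero normals. *)
Lemma free_pair_scale (a b : 'rV[R]_n) (c d : R) : free [:: a; b] -> c != 0 ->
  c *: a - d *: b != 0.
Proof.
rewrite free_cons span_seq1 => /andP[ab _] c0; apply: contraNneq ab => /eqP.
rewrite subr_eq0 => /eqP E; apply/vlineP; exists (c^-1 * d).
by rewrite -scalerA -E scalerA mulVf// scale1r.
Qed.

End GenericPlane.

(** * From the plane to R^n *)

Theorem theorem4p2 (R : realType) (n k s : nat) (n_gt0 : (0 < n)%N)
    (k_gt0 : (0 < k)%N) (a : 'I_k -> 'rV[R]_n)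
    (a_indep : forall i j : 'I_k, i != j -> free [:: a i; a j])
    (f : 'rV[R]_n -> R) (f_Cs : Cdiff s f)
    (f_sum : exists fi : 'I_k -> R -> R,
       forall x : 'rV[R]_n, f x = \sum_(i < k) fi i (dotp (a i) x)) :
  exists (g : 'I_k -> R -> R) (P : mpoly n R),
    [/\ forall i : 'I_k, Cdiff1 s (g i),
        (total_degree P <= k - 1)%N &
        forall x : 'rV[R]_n,
          f x = \sum_(i < k) g i (dotp (a i) x) + evalp P x].
Proof.
case: f_sum => fi fE.
(* A zero vector belongs to no free pair, so it can only be the sole vector; then f is constant and
   is taken as P. *)
have [[i0 ai0]|a_neq0] := pselect (exists i, a i = 0).
  have a0 j : a j = 0.
    have [->//|ij] := eqVneq j i0.
    have := free_not0 (a_indep j i0 ij) (v := a i0).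
    by rewrite ai0 !inE eqxx orbT => /(_ isT).
  exists (fun _ _ => 0), (mpolyC n (f 0)); split.
  - by move=> i; exact: Cdiff1_cst.
  - by rewrite /total_degree mmeasureC; case: (_ != _).
  - move=> x; rewrite big1// add0r /evalp mevalC !fE.
    by apply: eq_bigr => i _; rewrite a0 !dotp0l.
have [u uP] : exists u, forall w, w \in [seq a i | i <- enum 'I_k] -> dotp w u != 0.
  apply: avoid_hyperplanes; apply/mapP => -[i _ ai0].
  by apply: a_neq0; exists i.
have {uP} u0 i : dotp (a i) u != 0 by apply: uP; rewrite map_f ?mem_enum.
(* Avoiding these hyperplanes makes the quotients (a^i . v) / (a^i . u) pairwise distinct. *)
have [v vP] : exists v, forall w,
    w \in [seq dotp (a p.1) u *: a p.2 - dotp (a p.2) u *: a p.1 |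
           p : 'I_k * 'I_k <- enum {: 'I_k * 'I_k} & p.2 != p.1] -> dotp w v != 0.
  apply: avoid_hyperplanes; apply/mapP => -[[i j]].
  rewrite mem_filter /= => /andP[ij _] /esym/eqP; apply/negP.
  exact: free_pair_scale (a_indep _ _ ij) (u0 i).
pose lam i := dotp (a i) v / dotp (a i) u.
have lam_inj : injective lam.
  move=> i j lij; apply/eqP; apply: contraT => ij.
  have /vP : dotp (a j) u *: a i - dotp (a i) u *: a j \in
      [seq dotp (a p.1) u *: a p.2 - dotp (a p.2) u *: a p.1 |
        p : 'I_k * 'I_k <- enum {: 'I_k * 'I_k} & p.2 != p.1].
    by apply/mapP; exists (j, i) => //; rewrite mem_filter /= ij mem_enum.
  rewrite dotpBl !dotpZl -[dotp (a i) v](divfK (u0 i)) -[dotp (a j) v](divfK (u0 j)).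
  rewrite -/(lam i) -/(lam j) lij => /negP[]; apply/eqP; ring.
pose L (p : R * R) := p.1 *: u + p.2 *: v.
have LE i p : dotp (a i) (L p) = (p.1 + lam i * p.2) * dotp (a i) u.
  by rewrite /L dotpD !dotpZ /lam; field; exact: u0.
have cL : continuous L.
  move=> p; apply: cvgD; apply: cvgZr_tmp; [exact: cvg_fst|exact: cvg_snd].
have LD : {morph L : p q / p + q}.
  by move=> p q; rewrite /L !scalerDl addrACA.
have CL : Cdir s ((1, 0) : R * R) (f \o L).
  apply: Cdir_comp (Cdiff_Cdir u f_Cs) => // h p.
  by rewrite LD /L /= [h *: 1]mulr1 [h *: 0]mulr0 scale0r addr0.
have fLE p : (f \o L) p =
    \sum_(i < k) ridge (lam i) (fun t => fi i (t * dotp (a i) u)) p.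
  by rewrite /= fE; apply: eq_bigr => i _; rewrite LE.
have [|g [Cg gE]] := planar_smooth lam_inj (index_enum_uniq _) CL.
  rewrite (funext fLE).
  by apply: annihilated_sum => i ik; exact: (annihilated_ridge lam (fun t => fi i (t * _)) ik).
(* Both families represent f on the plane, so the ridge functions of the [H i] sum to zero there;
   eliminating the k - 1 others makes [H i] a generalized polynomial. *)
pose H i t := fi i (t * dotp (a i) u) - g i t.
have HP i : gpoly k.-1 (H i).
  have := @ridge_gpoly _ _ _ lam_inj (rem i (index_enum 'I_k)) 0 i H (fun=> 0).
  rewrite addn0 size_rem ?mem_index_enum// [X in X.-1](_ : _ = k); last first.
    by rewrite [index_enum _]unlock -enumT size_enum_ord.
  apply=> [|p|]; first by rewrite mem_rem_uniqF// index_enum_uniq.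
  - transitivity ((f \o L) p - (f \o L) p); last exact: subrr.
    by rewrite {1}fLE gE -sumrB [RHS](big_rem i)// mem_index_enum.
  - by move=> x.
(* Undoes the rescaling by a^i . u; the factor 1 matches the form of [Cdiff1_scale]. *)
pose G i t := 1 * g i (t * (dotp (a i) u)^-1).
pose r x := f x - \sum_(i < k) G i (dotp (a i) x).
have CG i : Cdiff1 s (G i) by exact: Cdiff1_scale.
(* This holds on all of R^n, since the [H i] are functions of one variable: the planar information
   on them carries over. *)
have rE : r = fun x => \sum_(i < k) H i (dotp (a i) x / dotp (a i) u).
  apply/funext => x; rewrite /r fE -sumrB; apply: eq_bigr => i _.
  by rewrite /H /G mul1r divfK.
have [P [dP PE]] : polyfun k.-1 r.
  apply: frechet.
    suff : continuous (fun x => -1 * \sum_(i < k) G i (dotp (a i) x) + f x).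
      by under eq_fun do rewrite mulN1r addrC.
    apply: continuousZD; last exact: Cdiff_continuous f_Cs.
    apply: continuous_sum => i _ x; apply: (@continuous_comp _ _ _ (dotp (a i)) (G i) x).
      exact: dotp_continuous.
    exact: (Cdiff1_continuous (CG i)).
  rewrite rE; apply: annihilated_sum => i _.
  apply: (gpoly_comp (L := fun x => dotp (a i) x / dotp (a i) u)); last exact: HP.
  by move=> x y; rewrite dotpD mulrDl.
exists G, P; split => //.
  by rewrite /total_degree subn1 (leq_trans _ dP)// leq_pred.
by move=> x; rewrite -PE /r addrC subrK.
Qed.
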